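(* Let $r\geq1$. For any compact group $K\leq\operatorname{O}(r)$ and any $n\geq2$, it holds that $$c_2\big((\mathbb R^r)^n/(K\ltimes\mathbb R^r)\big)=c_2\big((\mathbb R^r)^{n-1}/K\big).$$
   Context: $K\ltimes\mathbb R^r$ acts on $(\mathbb R^r)^n$ by $(A,b)\cdot(x_i)_{i=1}^n=(Ax_i+b)_{i=1}^n$, and $K$ acts diagonally on $(\mathbb R^r)^{n-1}$ by $A\cdot(x_i)_i=(Ax_i)_i$. The spaces $(\mathbb R^r)^n$ carry the standard Euclidean norm. If a group $G$ acts by isometries on a metric space $X$ with closed orbits, the orbit space $X/G$ carries the quotient metric $d([x],[y])=\inf_{p\in[x],\,q\in[y]}d_X(p,q)$, where $[x]=G\cdot x$. For a map $f\colon X\to Y$ of metric spaces, let $\alpha,\beta\in[0,\infty]$ be the largest and smallest constants (respectively) with $\alpha\, d_X(x,x')\le d_Y(f(x),f(x'))\le\beta\, d_X(x,x')$ for all $x,x'\in X$; the distortion of $f$ is $\kappa(f):=\beta/\alpha$, with $\kappa(f)=\infty$ if $\alpha=0$ or $\beta=\infty$. The Euclidean distortion $c_2(X)\in[1,\infty]$ is the infimum of all $c$ for which there exist a Hilbert space $H$ and a map $f\colon X\to H$ with $\kappa(f)=c$. *)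

(* Defs.v *)
From HB Require Import structures.
From mathcomp Require Import all_boot all_order all_algebra.
From mathcomp Require Import all_classical all_reals all_analysis.
From mathcomp Require Import ring.

Set Implicit Arguments.
Unset Strict Implicit.
Unset Printing Implicit Defensive.

Import Order.TTheory GRing.Theory Num.Theory.
Import numFieldNormedType.Exports.

Local Open Scope classical_set_scope.
Local Open Scope ring_scope.

(* Real Hilbert spaces. The metric structure carries no extra data: its balls *)
(* are those of the norm, which forces [mdist x y = `|x - y|].                *)
HB.mixin Record isHilbert (R : realType) V
    & CompleteNormedModule R V & Metric R V := {
  inner : {dot V for idfun : R -> R} ;
  inner_norm : forall x : V, inner x x = `|x| ^+ 2
}.

#[short(type="hilbertType")]
HB.structure Definition Hilbert (R : realType) :=
  {V of CompleteNormedModule R V & Metric R V & isHilbert R V}.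

Lemma hilbert_mdist (R : realType) (H : hilbertType R) (x y : H) :
  mdist x y = `|x - y|.
Proof.
have E d : (mdist x y < d) = (`|x - y| < d).
  have := @ballEmdist R H x d; rewrite -ball_normE /ball_ => /= E.
  have E' : (`|x - y| < d) = (mdist x y < d) :> Prop.
    exact: (congr1 (fun A : set H => A y) E).
  by apply/idP/idP; rewrite /is_true in E' *; rewrite E'.
by apply/eqP; rewrite eq_le leNgt -E ltxx/= leNgt E ltxx.
Qed.

Section distortion.
Context (R : realType).
Local Open Scope ereal_scope.

Definition lower_lip (X Y : metricType R) (f : X -> Y) : \bar R :=
  ereal_sup [set a | 0 <= a /\
    forall x x', a * (mdist x x')%:E <= (mdist (f x) (f x'))%:E].

Definition upper_lip (X Y : metricType R) (f : X -> Y) : \bar R :=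
  ereal_inf [set b | 0 <= b /\
    forall x x', (mdist (f x) (f x'))%:E <= b * (mdist x x')%:E].

Lemma lower_lip_attained (X Y : metricType R) (f : X -> Y) x x' :
  lower_lip f * (mdist x x')%:E <= (mdist (f x) (f x'))%:E.
Proof.
have [->|xx'] := eqVneq x x'; first by rewrite !mdistxx mule0.
have d0 : (0 < mdist x x')%R by rewrite mdist_gt0.
rewrite -lee_pdivlMr//; apply: ge_ereal_sup => a [_ /(_ x x')].
by rewrite lee_pdivlMr.
Qed.

Lemma upper_lip_attained (X Y : metricType R) (f : X -> Y) x x' :
  (mdist (f x) (f x'))%:E <= upper_lip f * (mdist x x')%:E.
Proof.
have [->|xx'] := eqVneq x x'; first by rewrite !mdistxx mule0.
have d0 : (0 < mdist x x')%R by rewrite mdist_gt0.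
rewrite -lee_pdivrMr//; apply: le_ereal_inf_tmp => a [_ /(_ x x')].
by rewrite lee_pdivrMr.
Qed.

(* The case split is needed: in [\bar R] the quotient [0 / 0] is [0], so a    *)
(* constant map would otherwise have distortion [0].                          *)
Definition distortion (X Y : metricType R) (f : X -> Y) : \bar R :=
  if (lower_lip f == 0) || (upper_lip f == +oo) then +oo
  else upper_lip f / lower_lip f.

Definition c2 (X : metricType R) : \bar R :=
  ereal_inf [set c | exists (H : hilbertType R) (f : X -> H), distortion f = c].

End distortion.

Record isometric_action (R : realType) (G : groupType) (X : metricType R) :=
  IsometricAction {
    act :> G -> X -> X ;
    act1 : forall x, act 1%g x = x ;
    actM : forall g h x, act (g * h)%g x = act g (act h x) ;
    act_isometry : forall g x y, mdist (act g x) (act g y) = mdist x y ;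
    act_closed : forall x, closed (range (act^~ x))
  }.

Section orbit_space.
Context (R : realType) (G : groupType) (X : metricType R).
Variable a : isometric_action G X.

Definition orbit_rel : rel X := fun x y => `[< exists g, a g x = y >].

Lemma orbit_rel_refl : reflexive orbit_rel.
Proof. by move=> x; apply/asboolP; exists 1%g; rewrite act1. Qed.

Lemma orbit_rel_sym : symmetric orbit_rel.
Proof.
have S x y : orbit_rel x y -> orbit_rel y x.
  move=> /asboolP[g <-]; apply/asboolP; exists g^-1%g.
  by rewrite -actM mulVg act1.
by move=> x y; apply/idP/idP; exact: S.
Qed.

Lemma orbit_rel_trans : transitive orbit_rel.
Proof.
move=> y x z /asboolP[g <-] /asboolP[h <-]; apply/asboolP.
by exists (h * g)%g; rewrite actM.
Qed.

Definition orbit_equiv :=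
  EquivRel orbit_rel orbit_rel_refl orbit_rel_sym orbit_rel_trans.

Definition orbit_space : Type := {eq_quot orbit_equiv}%qT.

HB.instance Definition _ := Choice.on orbit_space.
HB.instance Definition _ := Quotient.on orbit_space.

Local Notation pi := (\pi_orbit_space)%qT.

Lemma orbit_spaceP x y : pi x = pi y <-> exists g, a g x = y.
Proof.
split=> [E|E].
  by apply/asboolP; have /eqmodP := E.
by apply/eqmodP/asboolP.
Qed.

Definition orbit_dist (u v : orbit_space) : R :=
  inf [set mdist p q | p in [set p | pi p = u] & q in [set q | pi q = v]].

Lemma orbit_dist_le p q : orbit_dist (pi p) (pi q) <= mdist p q.
Proof.
apply: ge_inf; last by exists p => //; exists q.
by exists 0 => _ [p' _ [q' _ <-]]; exact: mdist_ge0.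
Qed.

Lemma orbit_dist_ge0 u v : 0 <= orbit_dist u v.
Proof.
apply: lb_le_inf; last by move=> _ [p' _ [q' _ <-]]; exact: mdist_ge0.
by exists (mdist (repr u) (repr v)); exists (repr u); rewrite /= ?reprK//;
  exists (repr v); rewrite /= ?reprK.
Qed.

Lemma orbit_dist_adherent p v e : 0 < e ->
  exists2 q, pi q = v & mdist p q < orbit_dist (pi p) v + e.
Proof.
move=> e0.
have [|_ [p' /= /esym/orbit_spaceP[g <-] [q' /= <-] <-] lt_e] :=
    @inf_adherent R [set mdist p q | p in [set p' | pi p' = pi p]
                              & q in [set q | pi q = v]] e e0.
  split; last by exists 0 => _ [p' _ [q' _ <-]]; exact: mdist_ge0.
  by exists (mdist p (repr v)); exists p => //; exists (repr v); rewrite /= ?reprK.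
exists (a g^-1%g q'); first by apply/esym/orbit_spaceP; exists g^-1%g.
by rewrite -(act_isometry a g) -actM mulgV act1.
Qed.

Lemma orbit_distxx u : orbit_dist u u = 0.
Proof.
apply/eqP; rewrite eq_le orbit_dist_ge0 andbT -[u]reprK.
by rewrite (le_trans (orbit_dist_le _ _))// mdistxx.
Qed.

Lemma orbit_dist_positivity u v : orbit_dist u v = 0 -> u = v.
Proof.
rewrite -[u]reprK -[v]reprK => uv0.
suff [g _ gx] : range (a^~ (repr v)) (repr u).
  by apply/esym/orbit_spaceP; exists g.
apply: (@act_closed _ _ _ a (repr v)) => B /nbhs_ballP[e /= e0 eB].
have [q /esym/orbit_spaceP[g gq] qe] :=
  orbit_dist_adherent (repr u) (pi (repr v)) e0.
exists q; split; first by exists g.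
by apply: eB; rewrite ballEmdist/= (lt_le_trans qe)// uv0 add0r.
Qed.

Lemma orbit_dist_triangle v u w :
  orbit_dist u w <= orbit_dist u v + orbit_dist v w.
Proof.
apply/ler_addgt0Pl => e e0; rewrite -[u]reprK; set p := repr u.
have e20 : 0 < e / 2 by rewrite divr_gt0.
have [q qv pq] := orbit_dist_adherent p v e20.
have [s sw qs] := orbit_dist_adherent q w e20.
rewrite qv in qs.
have := le_trans (orbit_dist_le p s) (metric_triangle p q s).
rewrite sw => /le_trans; apply; rewrite [e]splitr addrACA.
by rewrite lerD// addrC ltW.
Qed.

Lemma orbit_dist_sym u v : orbit_dist u v = orbit_dist v u.
Proof.
rewrite /orbit_dist; congr inf; apply/seteqP; split => _ [p pu [q qv <-]];
  by exists q => //; exists p => //; rewrite metric_sym.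
Qed.

HB.instance Definition _ := isMetric.Build R orbit_space
  orbit_distxx orbit_dist_positivity orbit_dist_sym orbit_dist_triangle.

Lemma orbit_space_mdistE (u v : orbit_space) : mdist u v = orbit_dist u v.
Proof. by []. Qed.

End orbit_space.

Section configurations.
Context (R : realType).

(* The library's norm on matrices is the sup norm, hence a separate type for  *)
(* [(R^r)^n] that carries the Euclidean distance.                             *)
Definition config (r n : nat) : Type := {ffun 'I_n -> 'cV[R]_r}.

HB.instance Definition _ r n := Choice.on (config r n).

Definition config_dist r n (x y : config r n) : R :=
  Num.sqrt (\sum_i \sum_j (x i j 0 - y i j 0) ^+ 2).

Lemma cauchy_schwarz_sum (I : finType) (f g : I -> R) :
  (\sum_i f i * g i) ^+ 2 <= (\sum_i f i ^+ 2) * (\sum_i g i ^+ 2).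
Proof.
rewrite -subr_ge0 -(pmulr_rge0 _ (ltr0n R 2)).
have -> : 2 * ((\sum_i f i ^+ 2) * (\sum_i g i ^+ 2) - (\sum_i f i * g i) ^+ 2) =
    \sum_i \sum_j (f i * g j - f j * g i) ^+ 2.
  have E : \sum_i \sum_j f i ^+ 2 * g j ^+ 2 =
      (\sum_i f i ^+ 2) * (\sum_i g i ^+ 2).
    by rewrite big_distrl/=; apply: eq_bigr => i _; rewrite big_distrr.
  rewrite mulrBr mulr_natl mulr2n -{1}E -E [X in _ + X - _]exchange_big/=.
  rewrite expr2 big_distrl/= big_distrr/= -big_split/= -sumrB.
  apply: eq_bigr => i _; rewrite !big_distrr/= -big_split/= -sumrB.
  by apply: eq_bigr => j _; ring.
by apply: sumr_ge0 => i _; apply: sumr_ge0 => j _; exact: sqr_ge0.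
Qed.

Lemma l2_triangle (I : finType) (f g : I -> R) :
  Num.sqrt (\sum_i (f i + g i) ^+ 2) <=
  Num.sqrt (\sum_i f i ^+ 2) + Num.sqrt (\sum_i g i ^+ 2).
Proof.
have s0 (h : I -> R) : 0 <= \sum_i h i ^+ 2.
  by apply: sumr_ge0 => i _; exact: sqr_ge0.
rewrite -ler_sqr ?nnegrE ?addr_ge0 ?sqrtr_ge0// sqrrD !sqr_sqrtr//.
have -> : \sum_i (f i + g i) ^+ 2 =
    \sum_i f i ^+ 2 + (\sum_i f i * g i) *+ 2 + \sum_i g i ^+ 2.
  rewrite -sumrMnl -!big_split/=.
  by apply: eq_bigr => i _; rewrite sqrrD.
rewrite lerD2r lerD2l lerMn2r/= -sqrtrM// (le_trans (ler_norm _))//.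
by rewrite -sqrtr_sqr ler_wsqrtr// cauchy_schwarz_sum.
Qed.

Lemma config_distxx r n (x : config r n) : config_dist x x = 0.
Proof.
rewrite /config_dist big1 ?sqrtr0// => i _; rewrite big1// => j _.
by rewrite subrr expr0n.
Qed.

Lemma config_dist_positivity r n (x y : config r n) :
  config_dist x y = 0 -> x = y.
Proof.
have s0 i : 0 <= \sum_j (x i j 0 - y i j 0) ^+ 2.
  by apply: sumr_ge0 => j _; exact: sqr_ge0.
move=> /eqP; rewrite sqrtr_eq0 le_eqVlt ltNge sumr_ge0// orbF.
rewrite psumr_eq0// => /allP/= xy; apply/ffunP => i; apply/colP => j.
have := xy i (mem_index_enum _); rewrite psumr_eq0; last by move=> *; exact: sqr_ge0.
by move=> /allP/(_ j (mem_index_enum _)); rewrite /= sqrf_eq0 subr_eq0 => /eqP.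
Qed.

Lemma config_dist_sym r n (x y : config r n) : config_dist x y = config_dist y x.
Proof.
congr Num.sqrt; apply: eq_bigr => i _; apply: eq_bigr => j _.
by rewrite -sqrrN opprB.
Qed.

Lemma config_dist_triangle r n (y x z : config r n) :
  config_dist x z <= config_dist x y + config_dist y z.
Proof.
rewrite /config_dist !pair_big/=.
apply: le_trans (l2_triangle (fun p : 'I_n * 'I_r => x p.1 p.2 0 - y p.1 p.2 0)
                             (fun p => y p.1 p.2 0 - z p.1 p.2 0)).
by apply: ler_wsqrtr; apply: ler_sum => p _; rewrite subrKA.
Qed.

HB.instance Definition _ r n := isMetric.Build R (config r n)
  (@config_distxx r n) (@config_dist_positivity r n)
  (@config_dist_sym r n) (@config_dist_triangle r n).

End configurations.

Record orthogonal_group (R : realType) (r : nat) := OrthogonalGroup {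
  og_set :> set 'M[R]_r ;
  og_orthogonal : forall A, og_set A -> A^T *m A = 1%:M ;
  og_one : og_set 1%:M ;
  og_mul : forall A B, og_set A -> og_set B -> og_set (A *m B) ;
  og_inv : forall A, og_set A -> og_set (invmx A)
}.

Section groups.
Context (R : realType) (r : nat) (K : orthogonal_group R r).

Definition og_elt : Type := {A : 'M[R]_r | A \in og_set K}.

HB.instance Definition _ := SubChoice.on og_elt.

Implicit Types A B C : og_elt.

Lemma og_eltP A : og_set K (val A).
Proof. by have := valP A; rewrite inE. Qed.

Lemma og_elt_unit A : val A \in unitmx.
Proof. by case: (mulmx1_unit (og_orthogonal (og_eltP A))). Qed.

Definition og_elt1 : og_elt := Sub 1%:M (mem_set (og_one K)).
Definition og_eltM A B : og_elt :=
  Sub (val A *m val B) (mem_set (og_mul (og_eltP A) (og_eltP B))).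
Definition og_eltV A : og_elt :=
  Sub (invmx (val A)) (mem_set (og_inv (og_eltP A))).

Lemma og_eltMA : associative og_eltM.
Proof. by move=> A B C; apply: val_inj; rewrite /= mulmxA. Qed.

Lemma og_elt1M : left_id og_elt1 og_eltM.
Proof. by move=> A; apply: val_inj; rewrite /= mul1mx. Qed.

Lemma og_eltM1 : right_id og_elt1 og_eltM.
Proof. by move=> A; apply: val_inj; rewrite /= mulmx1. Qed.

Lemma og_eltVM : left_inverse og_elt1 og_eltV og_eltM.
Proof. by move=> A; apply: val_inj; rewrite /= mulVmx ?og_elt_unit. Qed.

Lemma og_eltMV : right_inverse og_elt1 og_eltV og_eltM.
Proof. by move=> A; apply: val_inj; rewrite /= mulmxV ?og_elt_unit. Qed.

HB.instance Definition _ := isGroup.Build og_elt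
  og_eltMA og_elt1M og_eltM1 og_eltVM og_eltMV.

(* Semidirect product of [K] and [R^r]; [(A, b)] stands for [x |-> A x + b].  *)
Definition affine_elt : Type := (og_elt * 'cV[R]_r)%type.

HB.instance Definition _ := Choice.on affine_elt.

Implicit Types g h : affine_elt.

Definition affine1 : affine_elt := (1%g, 0).
Definition affineM g h : affine_elt :=
  ((g.1 * h.1)%g, val g.1 *m h.2 + g.2).
Definition affineV g : affine_elt :=
  ((g.1^-1)%g, - (invmx (val g.1) *m g.2)).

Lemma affineMA : associative affineM.
Proof.
move=> g h k; rewrite /affineM/=; congr pair; first exact: mulgA.
by rewrite mulmxDr mulmxA addrA.
Qed.

Lemma affine1M : left_id affine1 affineM.
Proof. by move=> [A b]; rewrite /affineM/= mul1g mul1mx addr0. Qed.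

Lemma affineM1 : right_id affine1 affineM.
Proof. by move=> [A b]; rewrite /affineM/= mulg1 mulmx0 add0r. Qed.

Lemma affineVM : left_inverse affine1 affineV affineM.
Proof. by move=> [A b]; rewrite /affineM/= mulVg subrr. Qed.

Lemma affineMV : right_inverse affine1 affineV affineM.
Proof.
move=> [A b]; rewrite /affineM/= mulgV mulmxN mulmxA mulmxV ?og_elt_unit//.
by rewrite mul1mx addNr.
Qed.

HB.instance Definition _ := isGroup.Build affine_elt
  affineMA affine1M affineM1 affineVM affineMV.

End groups.

Section actions.
Context (R : realType) (r : nat) (K : orthogonal_group R r) (Kc : compact K).

Definition sqn (v : 'cV[R]_r) : R := \sum_j v j 0 ^+ 2.

Lemma sqn_ge0 v : 0 <= sqn v.
Proof. by apply: sumr_ge0 => j _; exact: sqr_ge0. Qed.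

Lemma sqn_eq0 v : sqn v = 0 -> v = 0.
Proof.
move=> /eqP; rewrite psumr_eq0; last by move=> *; exact: sqr_ge0.
move=> /allP v0; apply/colP => j; rewrite mxE; apply/eqP.
by rewrite -sqrf_eq0 (implyP (v0 j (mem_index_enum _))).
Qed.

Lemma sqn_orthogonal (A : og_elt K) v : sqn (val A *m v) = sqn v.
Proof.
have E w : sqn w = (w^T *m w) 0 0.
  by rewrite mxE; apply: eq_bigr => j _; rewrite mxE expr2.
by rewrite !E trmx_mul mulmxA -(mulmxA v^T) (og_orthogonal (og_eltP A)) mulmx1.
Qed.

Lemma config_distE n (x y : config R r n) :
  mdist x y = Num.sqrt (\sum_i sqn (x i - y i)).
Proof.
congr Num.sqrt; apply: eq_bigr => i _; apply: eq_bigr => j _.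
by rewrite !mxE.
Qed.

Lemma compact_solution n (u v : 'I_n -> 'cV[R]_r) :
  (forall e, 0 < e ->
     exists2 A, og_set K A & \sum_i sqn (u i - A *m v i) < e) ->
  exists2 A, og_set K A & forall i, u i = A *m v i.
Proof.
pose F (A : 'M[R]_r) := \sum_i sqn (u i - A *m v i).
have cF : continuous F.
  apply: continuous_big => [|i _]; first exact: add_continuous.
  apply: continuous_big => [|j _]; first exact: add_continuous.
  have cE : continuous (fun A : 'M[R]_r => (u i - A *m v i) j 0).
    rewrite (_ : (fun _ => _) = fun A : 'M[R]_r => u i j 0 - \sum_k A j k * v i k 0).
      move=> A; apply: continuousB; first exact: cst_continuous.
      apply: continuous_big => [|k _ {}A]; first exact: add_continuous.
      apply: continuousM; first exact: coord_continuous.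
      exact: cst_continuous.
    by apply/funext => A; rewrite !mxE.
  rewrite (_ : (fun _ => _) = (fun A : 'M[R]_r =>
      (u i - A *m v i) j 0 * (u i - A *m v i) j 0)); last by apply/funext.
  by move=> A; apply: continuousM; exact: cE.
move=> small.
have K0 : (og_set K) !=set0 by exists 1%:M; exact: og_one.
have [A /set_mem KA minA] :=
  compact_EVT_min K0 Kc (continuous_subspaceT cF).
exists A => // i.
have FA0 : F A = 0.
  apply/eqP; rewrite eq_le sumr_ge0 ?andbT; last by move=> *; exact: sqn_ge0.
  rewrite leNgt; apply/negP => /small[B /mem_set/minA].
  by rewrite leNgt => /negP.
apply/eqP; rewrite -subr_eq0; apply/eqP/sqn_eq0.
move/eqP: FA0; rewrite psumr_eq0; last by move=> *; exact: sqn_ge0.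
by move=> /allP/(_ i (mem_index_enum _))/eqP.
Qed.

Section diagonal.
Variable n : nat.

Definition diagonal_act (A : og_elt K) (x : config R r n) : config R r n :=
  [ffun i => val A *m x i].

Lemma diagonal_act1 x : diagonal_act 1%g x = x.
Proof. by apply/ffunP => i; rewrite ffunE mul1mx. Qed.

Lemma diagonal_actM A B x :
  diagonal_act (A * B)%g x = diagonal_act A (diagonal_act B x).
Proof. by apply/ffunP => i; rewrite !ffunE mulmxA. Qed.

Lemma diagonal_isometry A x y :
  mdist (diagonal_act A x) (diagonal_act A y) = mdist x y.
Proof.
rewrite !config_distE; congr Num.sqrt; apply: eq_bigr => i _.
by rewrite !ffunE -mulmxBr sqn_orthogonal.
Qed.

Lemma diagonal_closed x : closed (range (diagonal_act^~ x)).
Proof.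
move=> y cly.
suff [A KA yA] : exists2 A, og_set K A & forall i, y i = A *m x i.
  by exists (Sub A (mem_set KA)) => //; apply/ffunP => i; rewrite ffunE yA.
apply: compact_solution => e e0.
have se0 : 0 < Num.sqrt e by rewrite sqrtr_gt0.
have [_ [[A _ <-]]] := cly _ (nbhsx_ballx y _ se0).
rewrite ballEmdist/= config_distE ltr_sqrt// => yA.
exists (val A); first exact: og_eltP.
apply: le_lt_trans yA; apply: ler_sum => i _.
by rewrite ffunE.
Qed.

Definition diagonal_action : isometric_action (og_elt K) (config R r n) :=
  IsometricAction diagonal_act1 diagonal_actM diagonal_isometry diagonal_closed.

End diagonal.

Section affine.
Variable n : nat.

Definition affine_act (g : affine_elt K) (x : config R r n) : config R r n :=
  [ffun i => val g.1 *m x i + g.2].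

Lemma affine_act1 x : affine_act 1%g x = x.
Proof. by apply/ffunP => i; rewrite ffunE mul1mx addr0. Qed.

Lemma affine_actM g h x :
  affine_act (g * h)%g x = affine_act g (affine_act h x).
Proof.
by apply/ffunP => i; rewrite !ffunE mulmxDr mulmxA addrA.
Qed.

Lemma affine_isometry g x y :
  mdist (affine_act g x) (affine_act g y) = mdist x y.
Proof.
rewrite !config_distE; congr Num.sqrt; apply: eq_bigr => i _.
by rewrite !ffunE opprD addrACA subrr addr0 -mulmxBr sqn_orthogonal.
Qed.

Definition mean (w : 'I_n -> 'cV[R]_r) : 'cV[R]_r := n%:R^-1 *: \sum_i w i.

Lemma sqn_mean (w : 'I_n -> 'cV[R]_r) :
  \sum_i sqn (w i - mean w) <= \sum_i sqn (w i).
Proof.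
rewrite [leLHS]exchange_big [leRHS]exchange_big/=; apply: ler_sum => j _.
set m := mean w j 0.
have S : \sum_i w i j 0 = n%:R * m.
  rewrite /m /mean mxE summxE; have [n0|n0] := eqVneq n 0%N.
    by rewrite big1 => [|i _]; [rewrite n0 mul0r|have := ltn_ord i; rewrite [X in (_ < X)%N]n0].
  by rewrite mulrA divff ?mul1r// pnatr_eq0.
have -> : \sum_i (w i - mean w) j 0 ^+ 2 =
    \sum_i w i j 0 ^+ 2 - n%:R * m ^+ 2.
  transitivity (\sum_i (w i j 0 ^+ 2 - w i j 0 * (2 * m) + m ^+ 2)).
    by apply: eq_bigr => i _; rewrite mxE [X in _ + X]mxE -/m; ring.
  rewrite big_split/= sumrB -big_distrl/= S sumr_const card_ord -mulr_natl.
  by ring.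
by rewrite gerBl mulr_ge0// sqr_ge0.
Qed.

Lemma affine_closed x : closed (range (affine_act^~ x)).
Proof.
move=> y cly.
suff [A KA yA] : exists2 A, og_set K A &
    forall i, y i - mean y = A *m (x i - mean x).
  exists (Sub A (mem_set KA), mean y - A *m mean x) => //.
  apply/ffunP => i; rewrite ffunE/= addrCA -mulmxBr -yA.
  by rewrite addrC subrK.
apply: compact_solution => e e0.
have se0 : 0 < Num.sqrt e by rewrite sqrtr_gt0.
have [_ [[[A b] _ <-]]] := cly _ (nbhsx_ballx y _ se0).
rewrite ballEmdist/= config_distE ltr_sqrt// => yA.
exists (val A); first exact: og_eltP.
apply: le_lt_trans yA.
have [n0|n0] := eqVneq n 0%N.
  by rewrite !big1// => i _; have := ltn_ord i; rewrite [X in (_ < X)%N]n0.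
apply: le_trans (le_trans (sqn_mean (fun i => y i - (val A *m x i + b))) _);
  last by apply: ler_sum => i _; rewrite ffunE.
apply: ler_sum => i _; rewrite le_eqVlt; apply/orP; left; apply/eqP.
have -> : mean (fun i => y i - (val A *m x i + b)) =
    mean y - (val A *m mean x + b).
  rewrite /mean sumrB scalerBr big_split/= scalerDr -mulmx_sumr scalemxAr.
  by rewrite sumr_const card_ord -[b *+ n]scaler_nat scalerA mulVf ?pnatr_eq0// scale1r.
congr sqn; rewrite mulmxBr; apply/colP => j.
move: (val A *m x i) (val A *m mean x) (mean y) => u v w.
by rewrite !mxE; ring.
Qed.

Definition affine_action : isometric_action (affine_elt K) (config R r n) :=
  IsometricAction affine_act1 affine_actM affine_isometry affine_closed.

End affine.

End actions.

(* Main.v *)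
(** Translations move a configuration along the constant configurations only,
    so a translation class is represented by its component orthogonal to the
    constants.  A Householder reflection of [R^n] that exchanges the first basis
    vector with a multiple of [(1, ..., 1)] identifies this complement with
    [(R^r)^(n-1)]; it mixes only the [n] indices and therefore commutes with [K].
    The two orbit spaces are thus isometric. *)

Require Import Defs.
From mathcomp Require Import all_boot all_order all_algebra.
From mathcomp Require Import ring.
From mathcomp Require Import all_classical all_reals all_analysis.
Import numFieldNormedType.Exports.
Import Order.TTheory GRing.Theory Num.Theory.

Set Implicit Arguments.
Unset Strict Implicit.
Unset Printing Implicit Defensive.

(** * Invariance of the Euclidean distortion under isometries *)

Section isometry_invariance.
Context (R : realType).
Local Open Scope classical_set_scope.
Local Open Scope ring_scope.

Lemma distortion_comp_isometry (X Y Z : metricType R) (f : X -> Y) (g : Y -> X)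
    (h : Y -> Z) :
  cancel g f -> (forall x x', mdist (f x) (f x') = mdist x x') ->
  distortion (h \o f) = distortion h.
Proof.
move=> gK f_iso.
(* As [g] makes [f] surjective, pairs in [X] and pairs in [Y] impose the same constraints.
   Abstracting over [P] serves both Lipschitz constants. *)
have surj (P : R -> Z -> Z -> Prop) :
    (forall x x', P (mdist x x') (h (f x)) (h (f x'))) <->
    (forall y y', P (mdist y y') (h y) (h y')).
  split=> [Pf y y'|Ph x x']; last by rewrite -f_iso.
  by have := Pf (g y) (g y'); rewrite -f_iso !gK.
have lowE : lower_lip (h \o f) = lower_lip h.
  congr ereal_sup; apply/seteqP; split=> a [a0 Ha]; split=> //.
    exact: ((surj (fun d z z' => a * d%:E <= (mdist z z')%:E)%E).1 Ha).
  exact: ((surj (fun d z z' => a * d%:E <= (mdist z z')%:E)%E).2 Ha).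
have upE : upper_lip (h \o f) = upper_lip h.
  congr ereal_inf; apply/seteqP; split=> b [b0 Hb]; split=> //.
    exact: ((surj (fun d z z' => (mdist z z')%:E <= b * d%:E)%E).1 Hb).
  exact: ((surj (fun d z z' => (mdist z z')%:E <= b * d%:E)%E).2 Hb).
by rewrite /distortion lowE upE.
Qed.

Lemma c2_isometry (X Y : metricType R) (f : X -> Y) (g : Y -> X) :
  cancel f g -> cancel g f -> (forall x x', mdist (f x) (f x') = mdist x x') ->
  c2 X = c2 Y.
Proof.
move=> fK gK f_iso.
have g_iso y y' : mdist (g y) (g y') = mdist y y' by rewrite -f_iso !gK.
congr ereal_inf; apply/seteqP; split=> _ [H [h <-]]; exists H.
  by exists (h \o g); exact: distortion_comp_isometry fK g_iso.
by exists (h \o f); exact: distortion_comp_isometry gK f_iso.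
Qed.

(** * Maps induced between orbit spaces *)

Section orbit_map.
Context (G H : groupType) (X Y : metricType R).
Context (a : isometric_action G X) (b : isometric_action H Y) (f : X -> Y).

Local Notation piX := (\pi_(orbit_space a))%qT.
Local Notation piY := (\pi_(orbit_space b))%qT.

Definition orbit_map (u : orbit_space a) : orbit_space b := piY (f (repr u)).

Hypothesis f_orbit : forall g x, exists h, b h (f x) = f (a g x).

Lemma orbit_map_pi x : orbit_map (piX x) = piY (f x).
Proof.
rewrite /orbit_map.
have /orbit_spaceP[g <-] : piX x = piX (repr (piX x)) by rewrite reprK.
exact/esym/orbit_spaceP/f_orbit.
Qed.

(** Every pair of representatives of [u] and [v] is sent to representatives of the image classes at
    no greater distance, so it bounds their infimum. *)
Lemma orbit_map_le u v :
  (forall x x', mdist (f x) (f x') <= mdist x x') ->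
  mdist (orbit_map u) (orbit_map v) <= mdist u v.
Proof.
move=> f_le; rewrite !orbit_space_mdistE; apply: lb_le_inf.
  exists (mdist (repr u) (repr v)); exists (repr u); rewrite /= ?reprK//.
  by exists (repr v); rewrite /= ?reprK.
move=> _ [p /= <- [q /= <- <-]]; rewrite !orbit_map_pi.
exact: le_trans (orbit_dist_le _ _ _) (f_le _ _).
Qed.

End orbit_map.

Arguments orbit_map {G H X Y} a b f u.

(** Neither map has to be an isometry: contractions that are mutually inverse up to orbits induce
    mutually inverse contractions of the quotients, hence isometries. *)
Lemma c2_orbit_space (G H : groupType) (X Y : metricType R)
    (a : isometric_action G X) (b : isometric_action H Y)
    (f : X -> Y) (f' : Y -> X) :
  (forall g x, exists h, b h (f x) = f (a g x)) ->
  (forall h y, exists g, a g (f' y) = f' (b h y)) ->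
  (forall x x', mdist (f x) (f x') <= mdist x x') ->
  (forall y y', mdist (f' y) (f' y') <= mdist y y') ->
  (forall x, exists g, a g (f' (f x)) = x) ->
  (forall y, exists h, b h (f (f' y)) = y) ->
  c2 (orbit_space a) = c2 (orbit_space b).
Proof.
move=> fo f'o f_le f'_le f'fK ff'K.
have FK : cancel (orbit_map a b f) (orbit_map b a f').
  move=> u; rewrite -[RHS]reprK; apply: (etrans (orbit_map_pi f'o _)).
  exact/orbit_spaceP.
have FK' : cancel (orbit_map b a f') (orbit_map a b f).
  move=> u; rewrite -[RHS]reprK; apply: (etrans (orbit_map_pi fo _)).
  exact/orbit_spaceP.
apply: (c2_isometry FK FK') => u v.
apply/eqP; rewrite eq_le orbit_map_le//=.
by rewrite -{1}[u]FK -{1}[v]FK orbit_map_le.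
Qed.

End isometry_invariance.

(** * The Householder reflection and its transpose *)

Section householder.
Context (R : realType) (r m : nat).
Local Open Scope ring_scope.

Implicit Types (x : 'I_m.+1 -> 'cV[R]_r) (y : 'I_m -> 'cV[R]_r).

Let d : R := (Num.sqrt m.+1%:R)^-1.
(** For the vector [v] of the reflection, |v|^2 = 2 (1 + d). Hence 2 v v^T / |v|^2 has entries [c]
    away from row and column 0, and [d] in the rest of column 0. *)
Let c : R := d ^+ 2 / (1 + d).

(* Rows [1, ..., m] of the reflection [1 - 2 v v^T / |v|^2] of [R^(m+1)], where *)
(* [v = e_0 + (d, ..., d)] and [d = 1 / sqrt (m + 1)].                          *)
Definition householder x (j : 'I_m) : 'cV[R]_r :=
  x (lift ord0 j) - c *: \sum_k x (lift ord0 k) - d *: x ord0.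

Definition householder_tr y (i : 'I_m.+1) : 'cV[R]_r :=
  if unlift ord0 i is Some j then y j - c *: \sum_k y k else - d *: \sum_k y k.

Let d_gt0 : 0 < d.
Proof. by rewrite invr_gt0 sqrtr_gt0 ltr0n. Qed.

Let d_sqr : d ^+ 2 = m.+1%:R^-1.
Proof. by rewrite exprVn sqr_sqrtr ?ler0n. Qed.

Let c_eq : c * (1 + d) = d ^+ 2.
Proof. by rewrite divfK// gt_eqF// addr_gt0. Qed.

(** From (m + 1) d^2 = 1 follows m d^2 = 1 - d^2 = (1 - d)(1 + d). *)
Let mc : m%:R * c = 1 - d.
Proof.
have d1 : 1 + d != 0 by rewrite gt_eqF// addr_gt0.
apply: (mulIf d1); rewrite -mulrA c_eq.
have : m.+1%:R * d ^+ 2 = 1 by rewrite d_sqr mulfV// pnatr_eq0.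
by rewrite -natr1 mulrDl mul1r => /(canRL (addrK _)) ->; ring.
Qed.

Lemma householder_tr0 y : householder_tr y ord0 = - d *: \sum_k y k.
Proof. by rewrite /householder_tr unlift_none. Qed.

Lemma householder_trS y j :
  householder_tr y (lift ord0 j) = y j - c *: \sum_k y k.
Proof. by rewrite /householder_tr liftK. Qed.

Let sum_householder_trS y :
  \sum_k householder_tr y (lift ord0 k) = d *: \sum_k y k.
Proof.
under eq_bigr do rewrite householder_trS.
rewrite sumrB sumr_const card_ord -scaler_nat scalerA mc.
by rewrite scalerBl scale1r opprB addrC subrK.
Qed.

(** The rows of an orthogonal matrix are orthonormal. *)
Lemma householderK y : householder (householder_tr y) =1 y.
Proof.
move=> j; rewrite /householder sum_householder_trS householder_trS.
rewrite householder_tr0; apply/colP => l.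
move: (\sum_k y k) (y j) => s v; rewrite !mxE.
transitivity (v l 0 + (d ^+ 2 - c * (1 + d)) * s l 0); first by ring.
by rewrite c_eq subrr mul0r addr0.
Qed.

(** Row 0 of the reflection is -(d, ..., d). Omitting it leaves the identity minus the projection
    onto the constants, whose entries are all d^2 = 1 / (m + 1). *)
Lemma householder_trK x i : householder_tr (householder x) i = x i - mean x.
Proof.
rewrite /mean -d_sqr big_ord_recl.
have S : \sum_k householder x k =
    d *: (\sum_k x (lift ord0 k)) - (m%:R * d) *: x ord0.
  rewrite /householder !sumrB !sumr_const card_ord.
  rewrite -(scaler_nat m (c *: _)) -(scaler_nat m (d *: _)) !scalerA mc.
  by rewrite scalerBl scale1r opprB [X in X - _]addrC subrK.
have md : m%:R * d ^+ 2 = 1 - d ^+ 2.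
  have : m.+1%:R * d ^+ 2 = 1 by rewrite d_sqr mulfV// pnatr_eq0.
  by rewrite -natr1 mulrDl mul1r => /(canRL (addrK _)).
case: (unliftP ord0 i) => [j|] ->.
  rewrite householder_trS S /householder; apply/colP => l.
  move: (\sum_k x _) (x ord0) (x (lift _ _)) => s x0 xj.
  rewrite !mxE -c_eq.
  have -> : c * (d * s l 0 - m%:R * d * x0 l 0) =
    c * d * s l 0 - (m%:R * c) * d * x0 l 0 by ring.
  (* The coefficient of [x0] is now -d + d (1 - d) = - d^2, that of [s] is - c (1 + d). *)
  rewrite mc; have -> : c * (1 + d) * (x0 l 0 + s l 0) =
    d ^+ 2 * x0 l 0 + c * (1 + d) * s l 0 by rewrite -c_eq; ring.
  by ring.
rewrite householder_tr0 S; apply/colP => l.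
move: (\sum_k x _) (x ord0) => s x0; rewrite !mxE.
have -> : - d * (d * s l 0 - m%:R * d * x0 l 0) =
  - d ^+ 2 * s l 0 + m%:R * d ^+ 2 * x0 l 0 by ring.
by rewrite md; ring.
Qed.

Lemma sqn_householder_tr y :
  \sum_i sqn (householder_tr y i) = \sum_j sqn (y j).
Proof.
rewrite [LHS]exchange_big [RHS]exchange_big/=; apply: eq_bigr => l _.
rewrite big_ord_recl; under [X in _ + X]eq_bigr do rewrite householder_trS.
rewrite householder_tr0; set s := (\sum_k y k) l 0.
have sE : \sum_k y k l 0 = s by rewrite /s summxE.
rewrite mxE -/s.
(* The terms in s^2 cancel: d^2 - 2 c + m c^2 = c (1 + d) - 2 c + c (1 - d) = 0. *)
transitivity ((- d * s) ^+ 2 +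
    \sum_j (y j l 0 ^+ 2 - y j l 0 * (2 * c * s) + (c * s) ^+ 2)).
  by congr (_ + _); apply: eq_bigr => j _; rewrite !mxE -/s; ring.
rewrite big_split/= sumrB -big_distrl/= sE sumr_const card_ord -(mulr_natl _ m).
have -> : m%:R * (c * s) ^+ 2 = (m%:R * c) * c * s ^+ 2 by ring.
rewrite mc; have -> : (- d * s) ^+ 2 = c * (1 + d) * s ^+ 2.
  by rewrite c_eq; ring.
by ring.
Qed.

(** The norm-preserving transpose turns the left side into the norm of the centred configuration. *)
Lemma sqn_householder x : \sum_j sqn (householder x j) <= \sum_i sqn (x i).
Proof.
rewrite -sqn_householder_tr.
under eq_bigr do rewrite householder_trK.
exact: sqn_mean.
Qed.

Lemma householderB x x' j :
  householder x j - householder x' j = householder (fun i => x i - x' i) j.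
Proof.
rewrite /householder sumrB !scalerBr; apply/colP => l.
by rewrite !mxE; ring.
Qed.

Lemma householder_trB y y' i :
  householder_tr y i - householder_tr y' i =
  householder_tr (fun j => y j - y' j) i.
Proof.
rewrite /householder_tr sumrB !scalerBr; case: unlift => [j|//].
by apply/colP => l; rewrite !mxE; ring.
Qed.

(** Translations vanish because each row sums to 1 - m c - d = 0; [A] commutes with the scalar
    coefficients. *)
Lemma householder_affine (A : 'M[R]_r) b x j :
  householder (fun i => A *m x i + b) j = A *m householder x j.
Proof.
rewrite /householder big_split/= -mulmx_sumr sumr_const card_ord -scaler_nat.
rewrite !mulmxBr -!scalemxAr !scalerDr scalerA [c * _]mulrC mc.
by apply/colP => l; rewrite !mxE; ring.
Qed.

Lemma householder_tr_mulmx (A : 'M[R]_r) y i :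
  householder_tr (fun j => A *m y j) i = A *m householder_tr y i.
Proof.
rewrite /householder_tr -mulmx_sumr; case: unlift => [j|].
  by rewrite mulmxBr scalemxAr.
by rewrite scalemxAr.
Qed.

Lemma eq_householder x x' : x =1 x' -> householder x =1 householder x'.
Proof. by move=> /funext ->. Qed.

Lemma eq_householder_tr y y' : y =1 y' -> householder_tr y =1 householder_tr y'.
Proof. by move=> /funext ->. Qed.

End householder.

Theorem theorem27 (R : realType) (r n : nat) (K : orthogonal_group R r)
    (Kc : compact (og_set K)) (hr : (1 <= r)%N) (hn : (2 <= n)%N) :
  c2 (orbit_space (affine_action Kc n)) =
  c2 (orbit_space (diagonal_action Kc n.-1)).
Proof.
case: n hn => // m _ /=.
pose f (x : config R r m.+1) : config R r m := finfun (householder x).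
pose f' (y : config R r m) : config R r m.+1 := finfun (householder_tr y).
apply: (@c2_orbit_space _ _ _ _ _ _ _ f f').
- move=> [A b] x; exists A; apply/ffunP => j; rewrite !ffunE.
  rewrite -(householder_affine _ b); apply: eq_householder => i.
  by rewrite ffunE.
- move=> A y; exists (A, 0%R); apply/ffunP => i; rewrite !ffunE addr0.
  rewrite -householder_tr_mulmx; apply: eq_householder_tr => j.
  by rewrite ffunE.
- move=> x x'; rewrite !config_distE; apply: ler_wsqrtr.
  under eq_bigr do rewrite !ffunE householderB.
  exact: sqn_householder.
- move=> y y'; rewrite !config_distE; apply: ler_wsqrtr.
  under eq_bigr do rewrite !ffunE householder_trB.
  by rewrite sqn_householder_tr.
(* The round trip subtracts the mean; translating by it returns to [x]. *)
- move=> x; exists (1%g, mean x); apply/ffunP => i; rewrite !ffunE mul1mx.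
  by rewrite (eq_householder_tr (ffunE _)) householder_trK subrK.
- move=> y; exists 1%g; apply/ffunP => j; rewrite !ffunE mul1mx.
  by rewrite (eq_householder (ffunE _)) householderK.
Qed.
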